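(* Let $m$ be a positive integer. Let $\mathcal{C}_m$ and $\mathcal{D}_m$ be the Shi arrangements of type C and type D. Then for all sufficiently large positive integers $q$, $$|M((\mathcal{C}_m)_q)|=(q-2m)^m$$ and $$|M((\mathcal{D}_m)_q)|=(q-2m+2)^m.$$
   Context: For $q\in\mathbb{Z}_{>0}$ put $\mathbb{Z}_q=\mathbb{Z}/q\mathbb{Z}$. A hyperplane $H$ given by an integral equation $a_1x_1+\cdots+a_mx_m=b$ ($a_k,b\in\mathbb{Z}$) defines $H[q]=\{x\in\mathbb{Z}_q^m \mid a_1x_1+\cdots+a_mx_m= b \text{ in } \mathbb{Z}_q\}$, using the equation exactly as written (so $\{2x_i=0\}$ is not replaced by $\{x_i=0\}$). For a finite set $\mathcal{A}$ of such hyperplanes, $M(\mathcal{A}_q)=\mathbb{Z}_q^m\setminus\bigcup_{H\in\mathcal{A}}H[q]$. The arrangements are $\mathcal{C}_m=\{\{2x_i=0\},\{2x_i=1\}\mid 1\le i\le m\}\cup\{\{x_i\pm x_j=0\},\{x_i\pm x_j=1\}\mid 1\leq i<j\leq m\}$ and $\mathcal{D}_m=\{\{x_i\pm x_j=0\},\{x_i\pm x_j=1\}\mid 1\leq i<j\leq m\}$. ''For all sufficiently large $q$'' means: there is $q_0$ such that the statement holds for every integer $q\ge q_0$. *)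

(* Defs.v *)
From HB Require Import structures.
From mathcomp Require Import all_boot all_order all_algebra.
Set Implicit Arguments.
Unset Strict Implicit.
Unset Printing Implicit Defensive.
Import GRing.Theory.
Local Open Scope ring_scope.

(* [(a, b)] stands for the equation a_1 x_1 + ... + a_m x_m = b, kept as
   written: proportional equations are different values, because their
   reductions modulo q can differ. *)
Definition hyperplane (m : nat) : Type := ('rV[int]_m * int)%type.

(* ['Z_q] is Z/qZ only for [1 < q]. *)
Definition hyperplane_mod (m q : nat) (H : hyperplane m) : {set 'rV['Z_q]_m} :=
  [set x : 'rV['Z_q]_m |
     \sum_(k < m) (H.1 0 k)%:~R * x 0 k == H.2%:~R].

Definition complement_mod (m q : nat) (A : seq (hyperplane m)) :
    {set 'rV['Z_q]_m} :=
  ~: \bigcup_(H <- A) hyperplane_mod q H.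

Definition coord_form (m : nat) (i : 'I_m) : 'rV[int]_m := delta_mx 0 i.

Definition shiD (m : nat) : seq (hyperplane m) :=
  flatten [seq [:: (coord_form i + coord_form j, 0);
                   (coord_form i + coord_form j, 1);
                   (coord_form i - coord_form j, 0);
                   (coord_form i - coord_form j, 1)]
          | i : 'I_m <- enum 'I_m,
            j : 'I_m <- [seq j : 'I_m <- enum 'I_m | (i < j)%N]].

Definition shiC (m : nat) : seq (hyperplane m) :=
  flatten [seq [:: (2 *: coord_form i, 0); (2 *: coord_form i, 1)]
          | i <- enum 'I_m]
  ++ shiD m.

(* Main.v *)
Require Import Defs.
From HB Require Import structures.
From mathcomp Require Import all_boot all_order all_algebra.
From mathcomp Require Import zify.
Set Implicit Arguments.
Unset Strict Implicit.
Unset Printing Implicit Defensive.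
Import GRing.Theory.

(** Picture a point x of the complement as the 2m labels x_1, ..., x_m,
-x_1, ..., -x_m placed symmetrically on the circle Z_q.  The idea is to erase
the positions a = x_1 and -a from the circle and to close the gaps: this leaves
a point of the complement for m - 1 on a circle with q - 2 positions.  It works
because x_1 and -x_1 are the two extreme labels for the order
1 < 2 < ... < m < -m < ... < -2 < -1, and the equations with right-hand side 1
say that labels +-x_i and +-x_j with i <> j on consecutive positions occur in
increasing order; so no other label stands just before x_1 or just after -x_1,
and closing the gaps creates no forbidden adjacency.

Conversely, [reinsert q a] reopens the gaps, and a point c for m - 1 on
Z_(q-2) extends by a exactly when each [reinsert q a (c_i)] is compatible
with a.  A given position u of the smaller circle is spoiled by exactly two
values of a ([shi_pair_reinsertN]), in general because reopening puts a just
after u or just after -u.  Compatible u and v are never spoiled by the same a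
([shi_pair_reinsert_or]).  So c always has N - 2(m - 1) extensions, where N is
the number of values allowed for one coordinate: q for type D, and q - 2 for
type C, because 2x = 0 and 2x = 1 have together two solutions whatever the
parity of q.  With q = n + 2m this factor is n + 2 for type D and n for
type C, and it is unchanged when (q, m) becomes (q - 2, m - 1); the counts
are therefore (n + 2)^m and n^m as soon as q >= 2m ([card_shi_configs]).

The positions 0 and, according to parity, q/2 or (q + 1)/2 need care only in
type D, where x_1 can be one of them.  The same formula for [reinsert] covers
these cases, so that no separate count according to parity is needed. *)

(** * Points of the complement on the circle of residues *)

(** Residues are represented by natural numbers below q.  Their sums are below
2q - 1, so that a congruence for x + y or x - y amounts to at most two
equalities, and linear arithmetic applies. *)
Definition shi_pair q x y :=
  [&& x != y, x != y + 1, x + q != y + 1,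
      x + y != 0, x + y != 1, x + y != q & x + y != q + 1].

Definition shi_single q x :=
  [&& 2 * x != 0, 2 * x != 1, 2 * x != q & 2 * x != q + 1].

(** For 0 < a < q with 2a <> q, the increasing enumeration of the positions
other than a and -a, which commutes with negation.  If a = -a, a label
compatible with a occupies none of a - 1, a, a + 1, and these three positions
are merged into one; the formula still enumerates all the remaining positions,
and it sends the merged one to a position incompatible with a. *)
Definition reinsert q a u :=
  u + (minn a (q - a) <= u) + (maxn a (q - a) <= u + 1).

Variant reinsert_spec p a u : nat -> Prop :=
  | ReinsertBefore of u < a & u + a < p.+2 : reinsert_spec p a u u
  | ReinsertAfterPos of a <= u & u + a <= p : reinsert_spec p a u u.+1
  | ReinsertAfterNeg of u.+1 < a & p.+2 <= u + a : reinsert_spec p a u u.+1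
  | ReinsertAfterBoth of a <= u.+1 & p < u + a : reinsert_spec p a u u.+2
  | ReinsertHalf of u.+1 = a & u + a = p.+1 : reinsert_spec p a u u.+1.

Lemma reinsertP p a u :
  a < p.+2 -> reinsert_spec p a u (reinsert p.+2 a u).
Proof.
move=> a_lt; rewrite /reinsert.
case: (leqP a (p.+2 - a)) => ?.
all: case: leqP => ?; case: (leqP _ (u + 1)) => ?; rewrite ?addn0 ?addn1.
all: first [ exfalso; lia | constructor 1; lia | constructor 2; lia
           | constructor 3; lia | constructor 4; lia | constructor 5; lia ].
Qed.

Lemma reinsert_lt p a u : a < p.+2 -> u < p -> reinsert p.+2 a u < p.+2.
Proof. by move=> a_lt u_lt; case: reinsertP => // *; lia. Qed.

Lemma reinsert_inj p a : a < p.+2 -> injective (reinsert p.+2 a).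
Proof.
move=> a_lt u v.
by case: (reinsertP u a_lt) => ? ?; case: (reinsertP v a_lt) => *; lia.
Qed.

Lemma reinsert_onto p a y : a < p.+2 -> y < p.+2 -> shi_pair p.+2 a y ->
  exists2 u, u < p & y = reinsert p.+2 a u.
Proof.
rewrite /shi_pair => a_lt y_lt ay.
exists (y - (minn a (p.+2 - a) < y) - (maxn a (p.+2 - a) < y)); first lia.
by case: reinsertP => // *; lia.
Qed.

(** Compatibility with a turns the case distinction of [reinsertP] into strict
intervals: the position of u keeps a distance from the two inserted points. *)
Variant compatible_spec p a u : nat -> Prop :=
  | CompatBefore of u.+1 < a & u + a <= p.+1 : compatible_spec p a u u
  | CompatAfterPos of a <= u & u + a <= p & 0 < u : compatible_spec p a u u.+1
  | CompatAfterNeg of u.+2 < a & p.+2 < u + a : compatible_spec p a u u.+1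
  | CompatAfterBoth of a <= u.+1 & p.+1 < u + a : compatible_spec p a u u.+2.

Lemma compatibleP p a u : a < p.+2 -> u < p ->
  shi_pair p.+2 a (reinsert p.+2 a u) ->
  compatible_spec p a u (reinsert p.+2 a u).
Proof.
rewrite /shi_pair => a_lt u_lt; case: reinsertP => // ? ?.
all: case/and5P=> ? ? ? ? /and3P[? ? ?].
all: first [ exfalso; lia | constructor 1; lia | constructor 2; lia
           | constructor 3; lia | constructor 4; lia ].
Qed.

(** Closing the gaps at a and -a makes no two labels adjacent in a forbidden
order, since a label compatible with a stands neither just before a nor just
after -a. *)
Lemma shi_pair_reinsert p a u v : a < p.+2 -> u < p -> v < p ->
  shi_pair p.+2 a (reinsert p.+2 a u) ->
  shi_pair p.+2 a (reinsert p.+2 a v) ->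
  shi_pair p.+2 (reinsert p.+2 a u) (reinsert p.+2 a v) = shi_pair p u v.
Proof.
move=> a_lt u_lt v_lt au av; rewrite /shi_pair.
case: (compatibleP a_lt u_lt au) => *; case: (compatibleP a_lt v_lt av) => *.
all: lia.
Qed.

(** The values of a that spoil u are those for which a is inserted just after u
or just after -u.  The shift by [p < 2 * u] accounts for -a, which is inserted
earlier on the circle than a when a lies past the middle.  If u = -u, that is
for u = 0 or 2u = p, the two insertions coincide, but the second spoiling value
is then 0 or p / 2 + 1, the value with a = -a whose surroundings are merged
into u. *)
Lemma shi_pair_reinsertN p a u : a < p.+2 -> u < p ->
  ~~ shi_pair p.+2 a (reinsert p.+2 a u) =
  (a == u + 1 + (p < 2 * u)) ||
  (a == if u == 0 then 0 else p.+2 - u - (p < 2 * u)).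
Proof.
rewrite /shi_pair => a_lt u_lt; case: reinsertP => // ? ?.
all: case: (eqVneq u 0) => ?; case: (ltnP p (2 * u)) => ?.
all: lia.
Qed.

(** Both u and v could be spoiled by the same a only for v = u or v = -u. *)
Lemma shi_pair_reinsert_or p a u v : a < p.+2 -> u < p -> v < p ->
  shi_pair p u v ->
  shi_pair p.+2 a (reinsert p.+2 a u) || shi_pair p.+2 a (reinsert p.+2 a v).
Proof.
rewrite /shi_pair => a_lt u_lt v_lt.
case: reinsertP => // ? ?; case: reinsertP => // ? ?.
all: lia.
Qed.

Lemma shi_single_reinsert p a u : a < p.+2 -> u < p ->
  shi_single p.+2 a -> shi_pair p.+2 a (reinsert p.+2 a u) ->
  shi_single p.+2 (reinsert p.+2 a u) = shi_single p u.
Proof.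
rewrite /shi_single /shi_pair => a_lt u_lt; case: reinsertP => // ? ?.
all: lia.
Qed.

(** In type C the two spoiling values of a are themselves allowed, so that they
do reduce the number of extensions. *)
Lemma shi_single_incompatible p a u : a < p.+2 -> u < p ->
  shi_single p u -> ~~ shi_pair p.+2 a (reinsert p.+2 a u) ->
  shi_single p.+2 a.
Proof.
rewrite /shi_single /shi_pair => a_lt u_lt; case: reinsertP => // ? ?.
all: lia.
Qed.

(** * Counting tuples with pairwise constraints *)

Definition configs (X : finType) (T : pred X) (r : rel X) (m : nat) :
    {set m.-tuple X} :=
  [set t : m.-tuple X | all T t && pairwise r t].

Lemma card_configs_cons (X : finType) (T : pred X) (r : rel X) m :
  #|configs T r m.+1| =
  \sum_(a | T a) #|[set t in configs T r m | all (r a) t]|.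
Proof.
rewrite -sum1_card (reindex (fun p : X * m.-tuple X => cons_tuple p.1 p.2)) /=.
  rewrite (eq_bigl (fun p : X * m.-tuple X =>
             T p.1 && (p.2 \in [set t in configs T r m | all (r p.1) t]))).
    rewrite -(pair_big_dep T
      (fun a t => t \in [set t in configs T r m | all (r a) t])
      (fun _ _ => 1)) /=.
    by apply: eq_bigr => a _; rewrite sum1_card.
  move=> [a t]; rewrite !inE /=.
  by rewrite -!andbA; do !bool_congr.
exists (fun t => (thead t, [tuple of behead t])) => [[a t] _|t _] /=.
  by rewrite theadE; congr (_, _); apply: val_inj.
by rewrite [RHS]tuple_eta; apply: val_inj.
Qed.

(** When f parametrizes the values allowed by p and transports the
constraints, a tuple of such values is the image of a unique tuple of
parameters. *)
Lemma card_extensions_fixed (X Y : finType) (T : pred X) (T' : pred Y)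
    (r : rel X) (r' : rel Y) (f : Y -> X) (p : pred X) m :
  injective f ->
  (forall x, p x -> exists u, x = f u) ->
  (forall u, p (f u) -> T (f u) = T' u) ->
  (forall u v, p (f u) -> p (f v) -> r (f u) (f v) = r' u v) ->
  #|[set t in configs T r m | all p t]| =
  #|[set s in configs T' r' m | all (preim f p) s]|.
Proof.
move=> f_inj f_onto fT fr.
have map_inj : injective (fun s : m.-tuple Y => [tuple of map f s]).
  by move=> s t /(congr1 val) /= /(inj_map f_inj) /val_inj.
rewrite -[RHS](card_imset _ map_inj); apply: eq_card => t.
have all_map_f s : all p (map f s) ->
    (all T (map f s) = all T' s) * (pairwise r (map f s) = pairwise r' s).
  move=> /[!all_map] ps; split.
    by apply: eq_in_all => u us; apply: fT; apply: (allP ps).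
  rewrite pairwise_map; apply: (@eq_in_pairwise _ (preim f p)) ps.
  by move=> u v; apply: fr.
apply/idP/imsetP => [|[s]].
  rewrite !inE => /andP[t_ok pt].
  have /fin_all_exists[g tE] : forall i, exists u, tnth t i = f u.
    by move=> i; apply: f_onto; apply: (allP pt); apply: mem_tnth.
  have mapE : t = [tuple of map f [tuple g i | i < m]].
    by apply: eq_from_tnth => i; rewrite tnth_map tnth_mktuple.
  exists [tuple g i | i < m] => //; rewrite mapE /= in t_ok pt.
  by rewrite !inE; have [<- <-] := all_map_f _ pt; rewrite t_ok -all_map pt.
rewrite !inE -all_map => /andP[s_ok ps] -> /=.
by have [-> ->] := all_map_f _ ps; rewrite s_ok ps.
Qed.

(** Pairwise compatible entries exclude disjoint sets of k values each. *)
Lemma card_avoid (X : finType) (U : Type) (T : pred X) (T' : pred U)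
    (r' : rel U) (b : X -> pred U) k (s : seq U) :
  (forall u, T' u -> #|[set a | T a & b a u]| = k) ->
  (forall a u v, r' u v -> b a u -> ~~ b a v) ->
  all T' s -> pairwise r' s ->
  #|[set a | T a & ~~ has (b a) s]| = #|T| - k * size s.
Proof.
move=> card_b disj_b Ts rs.
rewrite -[in RHS]cardsE -(cardsID [set a | has (b a) s] [set a | T a]).
have -> : #|[set a | T a] :&: [set a | has (b a) s]| = k * size s.
  elim: s Ts rs => [|u s IHs] /= => [_ _|/andP[Tu Ts] /andP[ru rs]].
    by rewrite muln0; apply: eq_card0 => a; rewrite !inE andbF.
  rewrite mulnS -(IHs Ts rs) -(card_b u Tu) -cardsUI.
  rewrite [X in _ = _ + X](_ : _ = 0) ?addn0.
    by apply: eq_card => a; rewrite !inE; case: (T a).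
  apply: eq_card0 => a; rewrite !inE; apply/negP.
  case/andP=> /andP[_ bu] /andP[_]; apply/negP; rewrite -all_predC.
  by apply: sub_all ru => v /disj_b/(_ bu).
by rewrite addKn; apply: eq_card => a; rewrite !inE andbC.
Qed.

(** The first coordinate a turns the rest of the tuple into a tuple for another
constraint system, through the reparametrization [f a]; exchanging the sums,
one counts for each tuple of that system the a that it admits, and the last two
hypotheses make this number independent of the tuple. *)
Lemma card_configs_succ (X Y : finType) (T : pred X) (T' : pred Y)
    (r : rel X) (r' : rel Y) (f : X -> Y -> X) k m :
  (forall a, injective (f a)) ->
  (forall a x, r a x -> exists u, x = f a u) ->
  (forall a u, T a -> r a (f a u) -> T (f a u) = T' u) ->
  (forall a u v, r a (f a u) -> r a (f a v) -> r (f a u) (f a v) = r' u v) ->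
  (forall u, T' u -> #|[set a | T a & ~~ r a (f a u)]| = k) ->
  (forall a u v, r' u v -> r a (f a u) || r a (f a v)) ->
  #|configs T r m.+1| = (#|T| - k * m) * #|configs T' r' m|.
Proof.
move=> f_inj f_onto fT fr card_f disj_f; rewrite card_configs_cons.
pose ok a s := (s \in configs T' r' m) && all (fun u => r a (f a u)) s.
transitivity (\sum_(a | T a) \sum_(s | ok a s) 1).
  apply: eq_bigr => a Ta; rewrite sum1_card.
  rewrite (card_extensions_fixed (T' := T') m (f_inj a) (f_onto a) _ (fr a));
    last first.
    by move=> u; apply: fT.
  by apply: eq_card => s; rewrite !inE [RHS]unfold_in !inE.
rewrite (exchange_big_dep (mem (configs T' r' m))) /=; last first.
  by move=> a s _ /andP[].
rewrite mulnC -sum_nat_const; apply: eq_bigr => s s_ok.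
have := s_ok; rewrite inE => /andP[Ts rs].
rewrite sum1_card -(size_tuple s).
rewrite -(card_avoid (b := fun a u => ~~ r a (f a u)) card_f _ Ts rs).
  apply: eq_card => a; rewrite !inE -all_predC /ok s_ok /=; congr (_ && _).
  by apply: eq_all => u; rewrite /= negbK.
by move=> a u v /(disj_f a)/orP[->|->].
Qed.

(** * The count for Shi configurations *)

Definition reinsert_ord p (a : 'I_p.+2) (u : 'I_p) : 'I_p.+2 :=
  inord (reinsert p.+2 a u).

Lemma reinsert_ordE p (a : 'I_p.+2) (u : 'I_p) :
  reinsert_ord a u = reinsert p.+2 a u :> nat.
Proof. by rewrite inordK //; apply: reinsert_lt. Qed.

Definition shi_rel q : rel 'I_q := fun x y => shi_pair q x y.
(** The flag c selects type C, where single coordinates are constrained too. *)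
Definition shi_pred (c : bool) q : pred 'I_q := fun x => c ==> shi_single q x.

(** The excluded values are 0 and the half of q or q + 1, according to the
parity of q: for even q the equation 2x = 0 has two solutions and 2x = 1 has
none, for odd q each has one. *)
Lemma card_shi_pred c p : #|@shi_pred c p.+2| = p + (~~ c).*2.
Proof.
case: c => /=; last by rewrite addn2 -[RHS]card_ord; apply: eq_card.
pose h : 'I_p.+2 := inord (p.+3)./2.
have hE : h = (p.+3)./2 :> nat by rewrite inordK //; lia.
have card_roots : #|[set ord0; h]| = 2.
  by rewrite cards2 -val_eqE /= hE; lia.
have := cardsC [set ord0; h]; rewrite card_roots card_ord => total.
suff -> : #|@shi_pred true p.+2| = #|~: [set ord0; h]| by lia.
apply: eq_card => x.
rewrite !inE unfold_in /shi_pred /= -!val_eqE /= hE /shi_single.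
have := ltn_ord x; lia.
Qed.

Lemma card_incompatible_ord c p (u : 'I_p) : shi_pred c u ->
  #|[set a | shi_pred c a & ~~ shi_rel a (reinsert_ord a u)]| = 2.
Proof.
move=> u_ok; have u_lt := ltn_ord u.
pose b1 : 'I_p.+2 := inord (u + 1 + (p < 2 * u)).
pose b2 : 'I_p.+2 :=
  inord (if u == 0 :> nat then 0 else p.+2 - u - (p < 2 * u)).
have b1E : b1 = u + 1 + (p < 2 * u) :> nat.
  by rewrite inordK //; case: ltnP => ?; lia.
have b2E : b2 = (if u == 0 :> nat then 0 else p.+2 - u - (p < 2 * u)) :> nat.
  rewrite inordK //.
  by case: (eqVneq (u : nat) 0) => ?; case: (ltnP p (2 * u)) => ?; lia.
transitivity #|[set b1; b2]|.
  apply: eq_card => a; rewrite !inE -!val_eqE /= b1E b2E.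
  rewrite -shi_pair_reinsertN // -reinsert_ordE /shi_rel andbC.
  case: (boolP (shi_pair _ _ _)) => //= bad_a; move: u_ok; rewrite /shi_pred.
  case: c => //= u_ok.
  apply: (shi_single_incompatible (ltn_ord a) u_lt u_ok).
  by rewrite -reinsert_ordE.
rewrite cards2 -val_eqE /= b1E b2E.
case: (eqVneq (u : nat) 0) => ?; case: (ltnP p (2 * u)) => ?; lia.
Qed.

(** The factor contributed by each coordinate depends on q - 2m only, which the
recursion preserves. *)
Lemma card_shi_configs c n m :
  #|configs (@shi_pred c (n + 2 * m)) (@shi_rel (n + 2 * m)) m| =
  (n + (~~ c).*2) ^ m.
Proof.
elim: m => [|m IHm].
  apply: etrans (cards1 ([tuple] : 0.-tuple 'I_(n + 2 * 0))).
  apply: eq_card => t.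
  by rewrite !inE tuple0 /= eqxx.
have -> : n + 2 * m.+1 = (n + 2 * m).+2 by lia.
set p := n + 2 * m in IHm *.
have := @card_configs_succ 'I_p.+2 'I_p (@shi_pred c _) (@shi_pred c _)
  (@shi_rel _) (@shi_rel _) (@reinsert_ord p) 2 m.
rewrite IHm card_shi_pred => -> //.
- by rewrite expnS; congr (_ * _); rewrite /p; lia.
- move=> a u v /(congr1 val); rewrite /= !reinsert_ordE => uv.
  by apply: val_inj; apply: reinsert_inj uv.
- move=> a x /reinsert_onto[] // u u_lt xE; exists (Ordinal u_lt).
  by apply: val_inj; rewrite /= reinsert_ordE.
- move=> a u; rewrite /shi_pred /shi_rel reinsert_ordE.
  by case: (c) => //= *; apply: shi_single_reinsert.
- move=> a u v; rewrite /shi_rel !reinsert_ordE; exact: shi_pair_reinsert.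
- exact: card_incompatible_ord.
- move=> a u v; rewrite /shi_rel !reinsert_ordE.
  exact: shi_pair_reinsert_or.
Qed.

(** * From tuples of residues to the arrangements *)

Local Open Scope ring_scope.

Lemma eq_modnD q a b k : (a < q)%N -> (b < q)%N -> (k < q)%N ->
  ((a + b) %% q == k)%N = ((a + b == k) || (a + b == q + k))%N.
Proof.
move=> a_lt b_lt k_lt; have [ab|ab] := ltnP (a + b)%N q.
  by rewrite modn_small //; lia.
by rewrite -{1}(subnK ab) modnDr modn_small; lia.
Qed.

Lemma Zp_add_eq p (x y : 'Z_p.+2) (k : nat) : (k < 2)%N ->
  (x + y == k%:R) = ((x + y == k :> nat)%N || (x + y == p.+2 + k :> nat)%N).
Proof.
move=> k_lt2; have k_lt : (k < p.+2)%N by lia.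
rewrite -val_eqE /= val_Zp_nat // (modn_small k_lt).
exact: eq_modnD (ltn_ord x) (ltn_ord y) k_lt.
Qed.

Lemma Zp_sub_eq p (x y : 'Z_p.+2) (k : nat) : (k < 2)%N ->
  (x - y == k%:R) = ((x == y + k :> nat)%N || (x + p.+2 == y + k :> nat)%N).
Proof.
move=> k_lt2; have k_lt : (k < p.+2)%N by lia.
rewrite subr_eq eq_sym addrC -val_eqE /= val_Zp_nat // (modn_small k_lt).
rewrite [LHS](eq_modnD (ltn_ord y) k_lt (ltn_ord x)).
by rewrite eq_sym (addnC x) [X in _ || X]eq_sym.
Qed.

Lemma shi_pairE p (x y : 'Z_p.+2) : shi_pair p.+2 x y =
  [&& x + y != 0, x + y != 1, x - y != 0 & x - y != 1].
Proof.
rewrite -[1]/1%:R -[0]/0%:R !Zp_sub_eq // !Zp_add_eq // /shi_pair.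
have : (x < p.+2)%N := ltn_ord x; have : (y < p.+2)%N := ltn_ord y.
by move: (x : nat) (y : nat) => a b; lia.
Qed.

Lemma shi_singleE p (x : 'Z_p.+2) : shi_single p.+2 x =
  (x + x != 0) && (x + x != 1).
Proof.
rewrite -[1]/1%:R -[0]/0%:R !Zp_add_eq // /shi_single.
by move: (x : nat) => a; lia.
Qed.

Definition form_mod m q (v : 'rV[int]_m) (x : 'rV['Z_q]_m) : 'Z_q :=
  \sum_(k < m) (v 0 k)%:~R * x 0 k.

Lemma form_modD m q (v w : 'rV[int]_m) (x : 'rV['Z_q]_m) :
  form_mod (v + w) x = form_mod v x + form_mod w x.
Proof.
rewrite -big_split; apply: eq_bigr => k _ /=.
by rewrite mxE rmorphD mulrDl.
Qed.

Lemma form_modN m q (v : 'rV[int]_m) (x : 'rV['Z_q]_m) :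
  form_mod (- v) x = - form_mod v x.
Proof.
rewrite -sumrN; apply: eq_bigr => k _ /=.
by rewrite mxE rmorphN mulNr.
Qed.

Lemma form_mod_coord m q (i : 'I_m) (x : 'rV['Z_q]_m) :
  form_mod (coord_form i) x = x 0 i.
Proof.
rewrite /form_mod (bigD1 i) //= big1 => [|k /negPf ki].
  by rewrite mxE !eqxx mul1r addr0.
by rewrite mxE ki andbF mul0r.
Qed.

Lemma in_complement_mod m q (A : seq (hyperplane m)) (x : 'rV['Z_q]_m) :
  (x \in complement_mod q A) =
  all (fun H : hyperplane m => form_mod H.1 x != H.2%:~R) A.
Proof.
rewrite inE; elim: A => [|H A IHA] /=; first by rewrite big_nil inE.
by rewrite big_cons inE negb_or IHA inE.
Qed.

Lemma all_flatten (T : Type) (a : pred T) (ss : seq (seq T)) :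
  all a (flatten ss) = all (all a) ss.
Proof. by elim: ss => //= s ss <-; rewrite all_cat. Qed.

Lemma pairwise_tupleP (T : Type) (r : rel T) m (t : m.-tuple T) :
  reflect (forall i j : 'I_m, (i < j)%N -> r (tnth t i) (tnth t j))
          (pairwise r t).
Proof.
case: m t => [|m] t.
  by rewrite tuple0; apply: (iffP idP) => // _ [].
apply: (iffP (pairwiseP (tnth_default t ord0))) => [rt i j ij|rt i j].
  by rewrite !(tnth_nth (tnth_default t ord0)) rt // inE size_tuple.
rewrite !inE size_tuple => i_lt j_lt ij.
by have := rt (Ordinal i_lt) (Ordinal j_lt) ij;
  rewrite !(tnth_nth (tnth_default t ord0)).
Qed.

Definition shi c m := if c then shiC m else shiD m.

Lemma in_shi_complement c m p (x : 'rV['Z_p.+2]_m) :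
  (x \in complement_mod p.+2 (shi c m)) =
  ([tuple x 0 i | i < m] \in configs (@shi_pred c p.+2) (@shi_rel p.+2) m).
Proof.
have inD : (x \in complement_mod p.+2 (shiD m)) =
           pairwise (@shi_rel p.+2) [tuple x 0 i | i < m].
  rewrite in_complement_mod all_flatten.
  apply/all_allpairsP/pairwise_tupleP => x_ok i j => [ij|_].
    have := x_ok i j (mem_enum _ _); rewrite mem_filter ij mem_enum => /(_ isT).
    rewrite !tnth_mktuple /shi_rel shi_pairE /=.
    by rewrite !form_modD !form_modN !form_mod_coord andbT.
  rewrite mem_filter => /andP[ij _].
  have := x_ok i j ij; rewrite !tnth_mktuple /shi_rel shi_pairE /=.
  by rewrite !form_modD !form_modN !form_mod_coord andbT.
rewrite [RHS]inE -inD; case: c => /=; last first.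
  by rewrite [X in _ = X && _](_ : _ = true) //; apply/allP.
rewrite !in_complement_mod all_cat; congr (_ && _).
rewrite all_flatten all_map.
apply/allP/(@all_tnthP m _ _ [tuple x 0 i | i < m]) => x_ok i; last first.
  move=> _; have := x_ok i; rewrite tnth_mktuple /shi_pred /= shi_singleE.
  by rewrite scaler_nat mulr2n form_modD form_mod_coord andbT.
have := x_ok i (mem_enum _ _); rewrite tnth_mktuple /shi_pred /= shi_singleE.
by rewrite scaler_nat mulr2n form_modD form_mod_coord andbT.
Qed.

Lemma card_shi_complement c n m : (1 < n + 2 * m)%N ->
  #|complement_mod (n + 2 * m) (shi c m)| = ((n + (~~ c).*2) ^ m)%N.
Proof.
rewrite -card_shi_configs; case: (n + 2 * m)%N => [|[|p]] // _.
rewrite -(on_card_preimset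
  (f := fun x : 'rV['Z_p.+2]_m => [tuple x 0 i | i < m])).
  by apply: eq_card => x; rewrite [RHS]inE in_shi_complement.
exists (fun t : m.-tuple 'I_p.+2 =>
          \row_i tnth t i : 'rV['Z_p.+2]_m) => [x _|t _].
  by apply/rowP => i; rewrite mxE tnth_mktuple.
by apply: eq_from_tnth => i; rewrite tnth_mktuple mxE.
Qed.

Theorem theorem1p2 (m : nat) (m_gt0 : (0 < m)%N) :
  exists2 q0 : nat, (1 < q0)%N &
    forall q : nat, (q0 <= q)%N ->
      #|complement_mod q (shiC m)|%:Z = (q%:Z - 2 * m%:Z) ^+ m
      /\ #|complement_mod q (shiD m)|%:Z = (q%:Z - 2 * m%:Z + 2) ^+ m.
Proof.
exists (2 * m)%N => [|q q_ge]; first lia.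
have q_gt1 : (1 < (q - 2 * m) + 2 * m)%N by lia.
have := card_shi_complement false q_gt1.
have := card_shi_complement true q_gt1.
rewrite (subnK q_ge) /= addn0 => -> ->.
by rewrite -!natz !natrX; split; congr (_ ^+ _); lia.
Qed.
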